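(* Let $H$ be a real Hilbert space, $C\subset H$ a nonempty closed convex set, $a_1,\dots,a_m\in H$ points that are not collinear, $A=\{a_1,\dots,a_m\}$, and $w_1,\dots,w_m>0$. Let $x_0\in C$ and let the sequence $\{x_k\}_{k\ge 0}$ be generated by the projected Weiszfeld algorithm $x_{k+1}=\Pi_C(T(x_k))$, $k\ge 0$. Suppose that $x_k\notin A$ for all $k\ge 0$. Then $\{x_k\}$ converges (in norm) to the unique solution $\bar x$ of $$\min\Big\{\sum_{i=1}^m w_i\|x-a_i\| : x\in C\Big\}.$$
   Context: Points are collinear if some straight line of $H$ contains all of them. $\Pi_C:H\to C$ is the metric projection onto $C$. The Weiszfeld mapping $T:H\to H$ is $$T(x)=\frac{1}{\sum_{i=1}^m \frac{w_i}{\|x-a_i\|}}\sum_{i=1}^m\frac{w_i a_i}{\|x-a_i\|}\quad\text{if } x\notin A,\qquad T(a_j)=a_j .$$ When the points $a_i$ are not collinear, the minimization problem has exactly one solution. *)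

(* Defs.v *)
From HB Require Import structures.
From mathcomp Require Import all_boot all_order all_algebra.
From mathcomp Require Import all_classical all_reals all_analysis.

Set Implicit Arguments.
Unset Strict Implicit.
Unset Printing Implicit Defensive.

Import Order.TTheory GRing.Theory Num.Theory.
Import numFieldNormedType.Exports.

Local Open Scope classical_set_scope.
Local Open Scope ring_scope.

(* The norm of H is the one induced by the inner product [dot]: together with
   completeness, this makes H a real Hilbert space. *)
Definition norm_induced_by (R : realType) (H : normedModType R)
    (dot : {dot H for (@idfun R)}) : Prop :=
  forall u : H, `|u| = Num.sqrt (dot u u).

Definition straight_line (R : realType) (H : normedModType R) (p v : H) :
  set H := [set p + t *: v | t in [set: R]].

Definition collinear (R : realType) (H : normedModType R) (S : set H) : Prop :=
  exists p v : H, v != 0 /\ S `<=` straight_line p v.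

Definition nearest_points (R : realType) (H : normedModType R)
    (C : set H) (y : H) : set H :=
  [set p | C p /\ forall z, C z -> `|y - p| <= `|y - z|].

(* For C nonempty, closed and convex in a Hilbert space, [nearest_points C y]
   is a singleton, and the default value y is never used. *)
Definition metric_proj (R : realType) (H : normedModType R)
    (C : set H) (y : H) : H :=
  xget y (nearest_points C y).

Definition weiszfeld (R : realType) (H : normedModType R) (m : nat)
    (a : 'I_m -> H) (w : 'I_m -> R) (x : H) : H :=
  if x \in range a then x
  else (\sum_(i < m) w i / `|x - a i|)^-1 *:
         \sum_(i < m) (w i / `|x - a i|) *: a i.

Definition weber_sum (R : realType) (H : normedModType R) (m : nat)
    (a : 'I_m -> H) (w : 'I_m -> R) (x : H) : R :=
  \sum_(i < m) w i * `|x - a i|.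

Definition minimizers (R : realType) (T : Type) (f : T -> R) (C : set T) :
  set T := [set x | C x /\ forall y, C y -> f x <= f y].

(* Main.v *)
(** Write f for the weighted sum of distances and, at x not in A, put
    c_i = w_i / |x - a_i| and s = sum_i c_i.  The projected Weiszfeld step
    p = Pi_C(T x) is characterized by
      sum_i c_i <a_i - p, z - p> <= 0   for all z in C,
    and everything is read off from this inequality:
    - z = x gives the descent s |x - p|^2 <= 2 (f x - f p), so consecutive
      iterates get arbitrarily close;
    - any z in C gives f x - f z <= (W + s |p - z|) |x - p|, with W = sum_i w_i,
      which forces f(x_k) to its minimum if x_k stays away from A infinitely
      often;
    - if f z < f c, then steps starting near c move away from c; so the
      iterates, which otherwise would have to converge to a point of A, cannot
      converge to a non-optimal one.
    Weak compactness is avoided: since the a_i are not collinear, f is uniformly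
    convex on its sublevel sets, which yields the existence of the minimizer and
    turns convergence of f(x_k) into norm convergence of x_k. *)
Require Import Defs.
From HB Require Import structures.
From mathcomp Require Import all_boot all_order all_algebra.
From mathcomp Require Import all_classical all_reals all_analysis.
From mathcomp Require Import ring lra.

Set Implicit Arguments.
Unset Strict Implicit.
Unset Printing Implicit Defensive.

Import Order.TTheory GRing.Theory Num.Theory.
Import numFieldNormedType.Exports.

Local Open Scope classical_set_scope.
Local Open Scope ring_scope.

(** * Inner product identities and Gram determinant estimates *)

Section InnerProduct.
Context (R : realType) (H : normedModType R) (dot : {dot H for (@idfun R)}).
Hypothesis Hdot : norm_induced_by dot.
Implicit Types (u v d e x y z : H) (t : R).

Lemma dotC u v : dot u v = dot v u.
Proof. by rewrite hermC expr0 mul1r. Qed.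

Lemma dotDl u v x : dot (u + v) x = dot u x + dot v x.
Proof. exact: linearDl. Qed.

Lemma dotDr u v x : dot x (u + v) = dot x u + dot x v.
Proof. exact: linearDr. Qed.

Lemma dotNl u v : dot (- u) v = - dot u v.
Proof. exact: linearNl. Qed.

Lemma dotNr u v : dot u (- v) = - dot u v.
Proof. exact: linearNr. Qed.

Lemma dotBl u v x : dot (u - v) x = dot u x - dot v x.
Proof. by rewrite dotDl dotNl. Qed.

Lemma dotBr u v x : dot x (u - v) = dot x u - dot x v.
Proof. by rewrite dotDr dotNr. Qed.

Lemma dotZl t u v : dot (t *: u) v = t * dot u v.
Proof. exact: linearZl_LR. Qed.

Lemma dotZr t u v : dot u (t *: v) = t * dot u v.
Proof. by rewrite dotC dotZl dotC. Qed.

Definition dotE := (dotBl, dotBr, dotDl, dotDr, dotNl, dotNr, dotZl, dotZr).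

Lemma dot_suml (I : Type) (r : seq I) (F : I -> H) v :
  dot (\sum_(i <- r) F i) v = \sum_(i <- r) dot (F i) v.
Proof. by rewrite linear_sumlz. Qed.

Lemma dot_ge0 u : 0 <= dot u u.
Proof.
have [->|u0] := eqVneq u 0; first by rewrite linear0r.
exact/ltW/neq0_dnorm_gt0.
Qed.

Lemma normsqE u : `|u| ^+ 2 = dot u u.
Proof. by rewrite Hdot sqr_sqrtr ?dot_ge0. Qed.

Lemma normsqD u v : `|u + v| ^+ 2 = `|u| ^+ 2 + 2 * dot u v + `|v| ^+ 2.
Proof. by rewrite !normsqE !dotE (dotC v u); ring. Qed.

Lemma normsqB u v : `|u - v| ^+ 2 = `|u| ^+ 2 - 2 * dot u v + `|v| ^+ 2.
Proof. by rewrite normsqD normrN dotNr; ring. Qed.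

Lemma dot_le_norm u v : dot u v <= `|u| * `|v|.
Proof.
have : `|u + v| ^+ 2 <= (`|u| + `|v|) ^+ 2.
  by rewrite ler_sqr ?nnegrE ?ler_normD ?addr_ge0.
by rewrite normsqD; lra.
Qed.

Lemma dot_ge_norm u v : - (`|u| * `|v|) <= dot u v.
Proof. by have := dot_le_norm (- u) v; rewrite normrN dotNl; lra. Qed.

Lemma sqr_dot_le u v : dot u v ^+ 2 <= `|u| ^+ 2 * `|v| ^+ 2.
Proof.
rewrite -exprMn -ler_sqrt ?exprn_ge0 ?mulr_ge0// !sqrtr_sqr.
rewrite (ger0_norm (_ : 0 <= `|u| * `|v|)) ?mulr_ge0//.
by rewrite ler_norml dot_le_norm dot_ge_norm.
Qed.

Lemma parallelogram u v :
  `|u - v| ^+ 2 = 2 * `|u| ^+ 2 + 2 * `|v| ^+ 2 - 4 * `|2^-1 *: (u + v)| ^+ 2.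
Proof.
by rewrite normrZ ger0_norm ?invr_ge0// exprMn normsqB normsqD; field.
Qed.

(* For a unit vector [e], the squared distance from [u] to the line spanned
   by [e]. *)
Definition dist2line u e : R := `|u| ^+ 2 - dot u e ^+ 2.

Lemma dist2line_ge0 u e : `|e| = 1 -> 0 <= dist2line u e.
Proof.
by move=> e1; have := sqr_dot_le u e; rewrite /dist2line e1 expr1n mulr1; lra.
Qed.

(** Parallelogram identity for the quadratic form [dist2line _ e], with the nonnegative term at
    [u + v] dropped. *)
Lemma dist2lineB u v e : `|e| = 1 ->
  dist2line (u - v) e <= 2 * dist2line u e + 2 * dist2line v e.
Proof.
move=> e1; have := dist2line_ge0 (u + v) e1.
by rewrite /dist2line normsqD normsqB !dotE; lra.
Qed.

(* With [b = beta e + b'] and [c = gamma e + c'], both [b'] and [c'] orthogonal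
   to [e], expand and use [|gamma b' + beta c'|^2 >= 0]. *)
Lemma gram_le_dist2line b c e : `|e| = 1 ->
  `|b| ^+ 2 * `|c| ^+ 2 - dot b c ^+ 2 <=
  3 * (`|b| ^+ 2 * dist2line c e + `|c| ^+ 2 * dist2line b e).
Proof.
move=> e1.
have hX := dist2line_ge0 b e1; have hY := dist2line_ge0 c e1.
have : 0 <= dist2line (dot c e *: b + dot b e *: c) e by exact: dist2line_ge0.
rewrite /dist2line in hX hY *.
rewrite normsqD !normrZ !exprMn !real_normK ?num_real// !dotE.
set B := `|b| ^+ 2 in hX *; set G := `|c| ^+ 2 in hY *.
set be := dot b e in hX *; set ga := dot c e in hY *; set q := dot b c.
move=> h.
have hXY : 0 <= (B - be ^+ 2) * (G - ga ^+ 2) by apply: mulr_ge0.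
have hb : 0 <= be ^+ 2 * (G - ga ^+ 2) by rewrite mulr_ge0 ?sqr_ge0.
have hc : 0 <= ga ^+ 2 * (B - be ^+ 2) by rewrite mulr_ge0 ?sqr_ge0.
have hq : 0 <= (q - be * ga) ^+ 2 by rewrite sqr_ge0.
by lra.
Qed.

(** The defect in Cauchy-Schwarz is controlled by the defect in the triangle inequality, since 2
    (|u||v| - <u,v>) = (|u| + |v|)^2 - |u + v|^2. The cofactors |u||v| + <u,v> and |u| + |v| + |u +
    v| are at most 2 M^2 and 4 M. *)
Lemma norm_convexity_gap u v (M : R) : `|u| <= M -> `|v| <= M ->
  `|u| ^+ 2 * `|v| ^+ 2 - dot u v ^+ 2 <=
  4 * M ^+ 3 * (`|u| + `|v| - `|u + v|).
Proof.
move=> uM vM.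
have := normsqD u v; have := ler_normD u v; have := normr_ge0 (u + v).
have := dot_le_norm u v; have := dot_ge_norm u v.
have := normr_ge0 u; have := normr_ge0 v.
set p := `|u| in uM *; set q := `|v| in vM *; set n := `|u + v|.
set t := dot u v => q0 p0 tl tu n0 npq nE.
have M0 : 0 <= M by lra.
have pq : p * q <= M ^+ 2 by rewrite expr2 ler_pM.
have h1 : (p * q - t) * (p * q + t) <= (p * q - t) * (2 * M ^+ 2).
  by apply: ler_wpM2l; lra.
have h2 : 2 * (p * q - t) = (p + q - n) * (p + q + n).
  by rewrite -[LHS]addr0 -(subrr (n ^+ 2)) {1}nE; ring.
have h3 : (p + q - n) * (p + q + n) <= (p + q - n) * (4 * M).
  by apply: ler_wpM2l; lra.
have h4 : (p * q - t) * (2 * M ^+ 2) <= (p + q - n) * (4 * M) * M ^+ 2.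
  rewrite mulrA (mulrC _ 2) h2; apply: ler_wpM2r; first exact: sqr_ge0.
  exact: h3.
by rewrite exprS; lra.
Qed.

End InnerProduct.

(** * Convex sets and well-posed minimization *)

Lemma convex_setP (R : realType) (H : normedModType R) (C : set H) (x y : H)
    (t : R) : convex_set C -> C x -> C y -> 0 <= t <= 1 ->
  C (t *: x + (1 - t) *: y).
Proof.
move=> Ccvx Cx Cy t01; have := Ccvx x y (Itv01 (andP t01).1 (andP t01).2).
by rewrite !inE; apply.
Qed.

Lemma convex_set_midpoint (R : realType) (H : normedModType R) (C : set H)
    (x y : H) : convex_set C -> C x -> C y -> C (2^-1 *: (x + y)).
Proof.
move=> Ccvx Cx Cy; have t01 : 0 <= (2^-1 : R) <= 1 by apply/andP; split; lra.
have := convex_setP Ccvx Cx Cy t01.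
by rewrite (_ : 1 - 2^-1 = 2^-1 :> R) ?scalerDr//; field.
Qed.

(* A strongly well-posed minimization problem: every minimizing sequence is a
   Cauchy sequence, so no compactness of [C] is needed. *)
Lemma exists_minimizer (R : realType) (H : completeNormedModType R)
    (C : set H) (F : H -> R) :
  C !=set0 -> closed C -> continuous F -> (forall x, 0 <= F x) ->
  (forall e : R, 0 < e -> exists2 eta : R, 0 < eta & forall x y, C x -> C y ->
     F x <= inf (F @` C) + eta -> F y <= inf (F @` C) + eta -> `|x - y| < e) ->
  exists x, minimizers F C x.
Proof.
move=> [x0 Cx0] Ccl Fcont F0 wp; set L := inf (F @` C).
have lbF : has_lbound (F @` C) by exists 0 => _ [x _ <-].
have infF : has_inf (F @` C) by split => //; exists (F x0); exists x0.
have /choice[y yP] n : exists y, C y /\ F y <= L + n.+1%:R^-1.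
  have n0 : 0 < n.+1%:R^-1 :> R by rewrite invr_gt0.
  by have [_ [y Cy <-] /ltW yL] := inf_adherent n0 infF; exists y.
have yC n : C (y n) by case: (yP n).
have yL (e : R) : 0 < e -> \forall n \near \oo, F (y n) <= L + e.
  move=> e0; near=> n; have [_] := yP n; move=> /le_trans; apply.
  rewrite lerD2l; near: n.
  have := near_infty_natSinv_lt (PosNum e0); apply: filterS => n /=.
  exact: ltW.
have /cauchy_cvgP ycvg : cauchy (y @ \oo).
  apply: cauchy_exP => e e0; have [eta eta0 etaP] := wp _ e0.
  have [N _ NP] := yL _ eta0.
  exists (y N); exists N => // n Nn; rewrite /= -ball_normE /=.
  by apply: etaP => //; apply: NP => /=.
exists (lim (y @ \oo)); split.
  by apply: (closed_cvg _ Ccl _ _ ycvg); exact: nearW.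
move=> z Cz; apply: (@le_trans _ _ L); last by apply: ge_inf => //; exists z.
apply/ler_addgt0Pr => e e0.
have Fy : F (y n) @[n --> \oo] --> F (lim (y @ \oo)).
  by apply: continuous_cvg => //; exact: Fcont.
have -> : F (lim (y @ \oo)) = lim (F (y n) @[n --> \oo]) by apply/esym/cvg_lim.
by apply: limr_le; [apply/cvg_ex; exists (F (lim (y @ \oo))) | exact: yL].
Unshelve. all: by end_near. Qed.

(** * Metric projection onto a closed convex set *)

Section Projection.
Context (R : realType) (H : completeNormedModType R).
Context (dot : {dot H for (@idfun R)}) (Hdot : norm_induced_by dot).
Context (C : set H) (C_neq0 : C !=set0) (C_closed : closed C).
Hypothesis C_convex : convex_set C.

Lemma metric_projP y : nearest_points C y (metric_proj C y).
Proof.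
apply: xgetPex.
suff : exists p, minimizers (fun p => `|y - p|) C p by [].
apply: exists_minimizer => //.
  move=> x; apply: cvg_norm; apply: cvgB; [exact: cvg_cst | exact: cvg_id].
move=> e e0; set L := inf _.
have L0 : 0 <= L.
  apply: lb_le_inf; last by move=> _ [x _ <-].
  by have [x Cx] := C_neq0; exists `|y - x|; exists x.
(* The midpoint of [p] and [q] lies in [C], at distance at least [L] from [y], so the parallelogram
   law gives |p - q|^2 <= 4 (L + eta)^2 - 4 L^2 = 8 L eta + 4 eta^2. *)
have [eta eta0 etaP] :
    exists2 eta : R, 0 < eta & 8 * L * eta + 4 * eta ^+ 2 < e ^+ 2.
  have L4 : 0 < 8 * L + 4 by lra.
  pose q := 2^-1 * e ^+ 2 / (8 * L + 4).
  have q0 : 0 < q by rewrite divr_gt0// mulr_gt0 ?exprn_gt0.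
  exists (Num.min 1 q); first by rewrite lt_min ltr01.
  have m1 : Num.min 1 q <= 1 by rewrite ge_min lexx.
  have mq : Num.min 1 q <= q by rewrite ge_min lexx orbT.
  have m0 : 0 < Num.min 1 q by rewrite lt_min ltr01.
  set mm := Num.min 1 q in m1 mq m0 *.
  apply: (@le_lt_trans _ _ ((8 * L + 4) * mm)).
    have : mm ^+ 2 <= mm by rewrite expr2 ler_piMl// ltW.
    by lra.
  apply: (@le_lt_trans _ _ (2^-1 * e ^+ 2)).
    by rewrite mulrC -ler_pdivlMr.
  by have := exprn_gt0 2 e0; lra.
exists eta => // p q Cp Cq pL qL.
rewrite -(@ltr_pXn2r _ 2) ?nnegrE//; last exact: ltW.
apply: le_lt_trans etaP.
have mid : L <= `|y - 2^-1 *: (p + q)|.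
  apply: ge_inf; first by exists 0 => _ [x _ <-].
  by exists (2^-1 *: (p + q)) => //; exact: convex_set_midpoint.
have := parallelogram Hdot (y - q) (y - p).
rewrite (_ : y - q - (y - p) = p - q); last by rewrite opprB addrC subrKA.
have -> : 2^-1 *: (y - q + (y - p)) = y - 2^-1 *: (p + q).
  rewrite addrACA -opprD [q + p]addrC scalerBr; congr (_ - _).
  by rewrite scalerDr -scalerDl (_ : 2^-1 + 2^-1 = 1 :> R) ?scale1r//; field.
move=> ->.
have h1 : `|y - p| ^+ 2 <= (L + eta) ^+ 2 by rewrite ler_sqr ?nnegrE//; lra.
have h2 : `|y - q| ^+ 2 <= (L + eta) ^+ 2 by rewrite ler_sqr ?nnegrE//; lra.
have h3 : L ^+ 2 <= `|y - 2^-1 *: (p + q)| ^+ 2 by rewrite ler_sqr ?nnegrE.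
by lra.
Qed.

Lemma metric_proj_in y : C (metric_proj C y).
Proof. by case: (metric_projP y). Qed.

Lemma metric_proj_vi y z : C z ->
  dot (y - metric_proj C y) (z - metric_proj C y) <= 0.
Proof.
move=> Cz; have [Cp pmin] := metric_projP y.
set p := metric_proj C y in Cp pmin *.
rewrite leNgt; apply/negP => dgt0.
set g := dot _ _ in dgt0; pose t := Num.min 1 (g / (`|z - p| ^+ 2 + 1)).
(* Moving from [p] towards [z] by [t] changes the squared distance to [y] by - 2 t g + t^2 |z -
   p|^2, which is negative because t |z - p|^2 <= g. *)
have n0 : 0 <= `|z - p| ^+ 2 by exact: sqr_ge0.
have n1 : 0 < `|z - p| ^+ 2 + 1 by lra.
have t0 : 0 < t by rewrite lt_min ltr01 divr_gt0.
have t1 : t <= 1 by rewrite ge_min lexx.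
have tg : t * (`|z - p| ^+ 2 + 1) <= g.
  by rewrite -ler_pdivlMr// ge_min lexx orbT.
have t01 : 0 <= t <= 1 by rewrite ltW.
have := pmin _ (convex_setP C_convex Cz Cp t01).
have -> : y - (t *: z + (1 - t) *: p) = (y - p) - t *: (z - p).
  by rewrite scalerBl scale1r -addrA -opprD scalerBr addrCA.
rewrite -ler_sqr ?nnegrE// (normsqB Hdot (y - p)) dotZr -/g.
rewrite normrZ exprMn (gtr0_norm t0).
have : t * (t * (`|z - p| ^+ 2 + 1)) <= t * g by rewrite ler_pM2l.
have : 0 < t * g by rewrite mulr_gt0.
by have := sqr_ge0 t; lra.
Qed.

End Projection.

(** * Uniform convexity of the objective for non-collinear points *)

Section UniformConvexity.
Context (R : realType) (H : normedModType R).
Context (dot : {dot H for (@idfun R)}) (Hdot : norm_induced_by dot).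
Context (m : nat) (a : 'I_m -> H) (w : 'I_m -> R).
Hypothesis w_gt0 : forall i, 0 < w i.
Local Notation f := (weber_sum a w).

(** Equality in Cauchy-Schwarz puts [a k] on the line through two distinct points [a i] and [a j].
    The vector [v] supplies a direction when there is no point or all of them coincide. *)
Lemma collinear_of_gram : (exists v : H, v != 0) ->
  (forall i j k, `|a j - a i| ^+ 2 * `|a k - a i| ^+ 2 <=
                 dot (a j - a i) (a k - a i) ^+ 2) ->
  collinear (range a).
Proof.
move=> [v v0] gram.
have [[i _]|nA] := pselect (exists i : 'I_m, True); last first.
  by exists 0, v; split => // _ [i _ <-]; exfalso; apply: nA; exists i.
have [[j aji]|aE] := pselect (exists j, a j != a i); last first.
  exists (a i), v; split => // _ [j _ <-]; exists 0 => //.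
  rewrite scale0r addr0; apply/esym/eqP; apply/negPn/negP => aji.
  by apply: aE; exists j.
have b0 : a j - a i != 0 by rewrite subr_eq0.
exists (a i), (a j - a i); split => // _ [k _ <-].
set b := a j - a i in b0 *; set c := a k - a i.
have bb0 : 0 < `|b| ^+ 2 by rewrite exprn_gt0 ?normr_gt0.
(* [t *: b] is the orthogonal projection of [c] onto the line of [b], and |b|^2 |c - t b|^2 is the
   Gram determinant of [b] and [c]. *)
pose t := dot b c / `|b| ^+ 2.
exists t => //; apply/eqP; rewrite eq_sym -subr_eq0 opprD addrA -/c.
rewrite -normr_eq0 -sqrf_eq0.
rewrite eq_le sqr_ge0 andbT -(pmulr_rle0 _ bb0) (normsqB Hdot c) normrZ exprMn.
rewrite real_normK ?num_real// dotZr (dotC dot c).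
have tE : t * `|b| ^+ 2 = dot b c by rewrite divfK// gt_eqF.
have -> : `|b| ^+ 2 * (`|c| ^+ 2 - 2 * (t * dot b c) + t ^+ 2 * `|b| ^+ 2) =
    `|b| ^+ 2 * `|c| ^+ 2 - dot b c ^+ 2 + (t * `|b| ^+ 2 - dot b c) ^+ 2.
  by ring.
by rewrite tE subrr expr0n addr0 subr_le0; exact: gram.
Qed.

Lemma exists_gram_gt0 : (exists v : H, v != 0) -> ~ collinear (range a) ->
  exists i j k, 0 < `|a j - a i| ^+ 2 * `|a k - a i| ^+ 2 -
                    dot (a j - a i) (a k - a i) ^+ 2.
Proof.
move=> v0 ncol; apply: contrapT => nG; apply/ncol/collinear_of_gram => // i j k.
rewrite leNgt; apply/negP => G0; apply: nG; exists i, j, k.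
by rewrite subr_gt0.
Qed.

Lemma weber_midpoint_gap x y i :
  w i * (`|x - a i| + `|y - a i| - `|(x - a i) + (y - a i)|) <=
  f x + f y - 2 * f (2^-1 *: (x + y)).
Proof.
rewrite /weber_sum mulr_sumr -big_split -sumrB /=.
have E j : w j * `|x - a j| + w j * `|y - a j| -
    2 * (w j * `|2^-1 *: (x + y) - a j|) =
    w j * (`|x - a j| + `|y - a j| - `|(x - a j) + (y - a j)|).
  have -> : 2^-1 *: (x + y) - a j = 2^-1 *: ((x - a j) + (y - a j)).
    rewrite addrACA -opprD scalerBr; congr (_ - _).
    by rewrite scalerDr -scalerDl (_ : 2^-1 + 2^-1 = 1 :> R) ?scale1r//; field.
  by rewrite normrZ ger0_norm ?invr_ge0//; field.
rewrite (eq_bigr _ (fun j _ => E j)) (bigD1 i)//= lerDl sumr_ge0// => j _.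
by rewrite mulr_ge0 ?(ltW (w_gt0 j))// subr_ge0 ler_normD.
Qed.

(** For [e] the direction of [y - x], |x - y|^2 times [dist2line dot (x - a l) e] is the Gram
    determinant of [x - a l] and [y - a l], hence bounded by the midpoint gap. Three points with
    Gram determinant [G > 0] cannot all be near the line through [x] and [y], so it is |x - y| that
    must be small. *)
Lemma weber_uniformly_convex :
  (exists v : H, v != 0) -> ~ collinear (range a) ->
  exists2 K, 0 <= K & forall M x y,
    (forall i, `|x - a i| <= M) -> (forall i, `|y - a i| <= M) ->
    `|x - y| ^+ 2 <= K * M ^+ 3 * (f x + f y - 2 * f (2^-1 *: (x + y))).
Proof.
move=> v0 /(exists_gram_gt0 v0)[i [j [k]]].
set B := `|a j - a i| ^+ 2; set C := `|a k - a i| ^+ 2; set G := _ - _ => G0.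
have B0 : 0 <= B := sqr_ge0 _; have C0 : 0 <= C := sqr_ge0 _.
have W0 l : 0 <= (w l)^-1 by rewrite invr_ge0 ltW.
(* 24 = 3 * 2 * 4, from [gram_le_dist2line], [dist2lineB] and [norm_convexity_gap]. *)
exists (24 * (B * ((w k)^-1 + (w i)^-1) + C * ((w j)^-1 + (w i)^-1)) / G).
  by rewrite divr_ge0 ?(ltW G0)// mulr_ge0// addr_ge0// mulr_ge0// addr_ge0.
move=> M x y xM yM; have M0 : 0 <= M by exact: le_trans (xM i).
set T := f x + f y - _.
have M3 : 0 <= 4 * M ^+ 3 by rewrite mulr_ge0// exprn_ge0.
have T0 : 0 <= T.
  apply: le_trans (weber_midpoint_gap x y i).
  by rewrite mulr_ge0 ?(ltW (w_gt0 i))// subr_ge0 ler_normD.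
have Q0 : 0 <= B * ((w k)^-1 + (w i)^-1) + C * ((w j)^-1 + (w i)^-1).
  by rewrite addr_ge0// mulr_ge0// addr_ge0.
have [->|xy] := eqVneq x y.
  rewrite subrr normr0 expr0n mulr_ge0// mulr_ge0// ?exprn_ge0//.
  by rewrite divr_ge0 ?(ltW G0)// mulr_ge0.
have n0 : `|y - x| != 0 by rewrite normr_eq0 subr_eq0 eq_sym.
pose e := `|y - x|^-1 *: (y - x).
have e1 : `|e| = 1 by rewrite normrZ normfV normr_id mulVf.
have dE : y - x = `|y - x| *: e by rewrite scalerA divff// scale1r.
have key l : `|x - y| ^+ 2 * dist2line dot (x - a l) e <=
    4 * M ^+ 3 * T * (w l)^-1.
  have -> : `|x - y| ^+ 2 * dist2line dot (x - a l) e =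
      `|x - a l| ^+ 2 * `|y - a l| ^+ 2 - dot (x - a l) (y - a l) ^+ 2.
    have -> : y - a l = (x - a l) + `|y - x| *: e.
      by rewrite -dE [RHS]addrC subrKA.
    rewrite distrC (normsqD Hdot (x - a l)) dotDr dotZr normrZ normr_id.
    rewrite e1 mulr1.
    by rewrite -(normsqE Hdot) /dist2line; ring.
  apply: le_trans (norm_convexity_gap Hdot (xM l) (yM l)) _.
  rewrite -[leRHS]mulrA ler_wpM2l// -ler_pdivrMr ?invr_gt0// invrK mulrC.
  exact: weber_midpoint_gap.
have bE l : a l - a i = (x - a i) - (x - a l).
  by rewrite opprB [RHS]addrC subrKA.
have gram := gram_le_dist2line Hdot (a j - a i) (a k - a i) e1.
have hb := dist2lineB Hdot (x - a i) (x - a j) e1.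
have hc := dist2lineB Hdot (x - a i) (x - a k) e1.
rewrite -!bE in hb hc; rewrite -/B -/C -/G in gram.
have N0 := sqr_ge0 `|x - y|.
have GN : `|x - y| ^+ 2 * G <= 6 * (4 * M ^+ 3 * T *
    (B * ((w k)^-1 + (w i)^-1) + C * ((w j)^-1 + (w i)^-1))).
  apply: le_trans (ler_wpM2l N0 gram) _.
  have := ler_wpM2l B0 (ler_wpM2l N0 hc).
  have := ler_wpM2l C0 (ler_wpM2l N0 hb).
  have := ler_wpM2l B0 (lerD (key i) (key k)).
  have := ler_wpM2l C0 (lerD (key i) (key j)).
  by lra.
rewrite -(ler_pM2r G0); apply: le_trans GN _.
rewrite le_eqVlt; apply/orP; left; apply/eqP; field.
by rewrite gt_eqF ?gt_eqF ?w_gt0.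
Qed.

End UniformConvexity.

Lemma exists_pos_lower_bound (R : realType) (I : finType) (P : pred I)
    (g : I -> R) : (forall i, P i -> 0 < g i) ->
  exists2 rho, 0 < rho & forall i, P i -> rho <= g i.
Proof.
(* The initial value 1 keeps the minimum positive even if no index satisfies [P]. *)
move=> g0; exists (\big[Num.min/1]_(i | P i) g i).
  by rewrite lt_bigmin ?ltr01//.
by move=> i Pi; exact: bigmin_le_cond.
Qed.

(** * The objective: continuity, existence of a minimizer, quadratic growth *)

Section WeberSum.
Context (R : realType) (H : normedModType R).
Context (m : nat) (a : 'I_m -> H) (w : 'I_m -> R).
Hypothesis w_gt0 : forall i, 0 < w i.
Local Notation f := (weber_sum a w).

Lemma weber_term_le x i : w i * `|x - a i| <= f x.
Proof.
rewrite /weber_sum (bigD1 i)//= lerDl sumr_ge0// => j _.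
by rewrite mulr_ge0// ltW.
Qed.

Lemma weber_sum_ge0 x : 0 <= f x.
Proof. by apply: sumr_ge0 => i _; rewrite mulr_ge0// ltW. Qed.

Lemma continuous_weber_sum : continuous f.
Proof.
move=> x; apply: cvg_big => [|i _]; first exact: add_continuous.
apply: cvgM; first exact: cvg_cst.
by apply: cvg_norm; apply: cvgB; [exact: cvg_id|exact: cvg_cst].
Qed.

End WeberSum.

Section WeberMinimizer.
Context (R : realType) (H : completeNormedModType R).
Context (dot : {dot H for (@idfun R)}) (Hdot : norm_induced_by dot).
Context (m : nat) (a : 'I_m -> H) (w : 'I_m -> R).
Hypothesis w_gt0 : forall i, 0 < w i.
Hypotheses (H_neq0 : exists v : H, v != 0) (a_ncol : ~ collinear (range a)).
Context (C : set H) (C_neq0 : C !=set0) (C_closed : closed C).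
Hypothesis C_convex : convex_set C.
Local Notation f := (weber_sum a w).

Lemma weber_uniformly_convex_sublevel L : exists2 K, 0 < K & forall x y,
  f x <= L -> f y <= L ->
  `|x - y| ^+ 2 <= K * (f x + f y - 2 * f (2^-1 *: (x + y))).
Proof.
have [K K0 KP] := weber_uniformly_convex Hdot w_gt0 H_neq0 a_ncol.
have [L0|L0] := ltP L 0.
  by exists 1 => // x y xL; have := weber_sum_ge0 a w_gt0 x; lra.
have W0 i : 0 < (w i)^-1 by rewrite invr_gt0.
(* On the sublevel set w_i |x - a_i| <= f x <= L, so this [M] serves all indices at once. *)
pose M := L * \sum_i (w i)^-1.
have M0 : 0 <= M by rewrite mulr_ge0// sumr_ge0// => i _; exact: ltW.
have bnd x i : f x <= L -> `|x - a i| <= M.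
  move=> xL; have := le_trans (weber_term_le a w_gt0 x i) xL.
  rewrite mulrC -ler_pdivlMr// => /le_trans; apply; rewrite ler_wpM2l//.
  by rewrite (bigD1 i)//= lerDl sumr_ge0// => j _; exact: ltW.
have KM : 0 <= K * M ^+ 3 by rewrite mulr_ge0// exprn_ge0.
exists (K * M ^+ 3 + 1) => [|x y xL yL]; first lra.
have le := KP M x y (fun i => bnd x i xL) (fun i => bnd y i yL).
apply: le_trans le _; rewrite [leRHS]mulrDl mul1r lerDl.
have [[i _]|nI] := pselect (exists i : 'I_m, True).
  apply: le_trans _ (weber_midpoint_gap a w_gt0 x y i).
  by rewrite mulr_ge0 ?(ltW (w_gt0 i))// subr_ge0 ler_normD.
rewrite /weber_sum !big1 ?mulr0 ?addr0 ?subr0// => i.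
all: by exfalso; apply: nI; exists i.
Qed.

Lemma exists_weber_minimizer : exists x, minimizers f C x.
Proof.
apply: exists_minimizer => //; first exact: continuous_weber_sum.
  exact: weber_sum_ge0.
set L := inf _ => e e0.
have [K K0 KP] := weber_uniformly_convex_sublevel (L + 1).
pose q := e ^+ 2 / (2 * K + 1).
have K1 : 0 < 2 * K + 1 by lra.
have q0 : 0 < q by rewrite divr_gt0// exprn_gt0.
(* The cap 1 keeps both points in the sublevel set of [L + 1]; the bound [q] makes K * 2t < (2K + 1)
   t <= e^2. *)
exists (Num.min 1 q); first by rewrite lt_min ltr01.
have m1 : Num.min 1 q <= 1 by rewrite ge_min lexx.
have mq : (2 * K + 1) * Num.min 1 q <= e ^+ 2.
  by rewrite mulrC -ler_pdivlMr// ge_min lexx orbT.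
have m0 : 0 < Num.min 1 q by rewrite lt_min ltr01.
set t := Num.min 1 q in m1 mq m0 * => x y Cx Cy xL yL.
have mid : L <= f (2^-1 *: (x + y)).
  apply: ge_inf; first by exists 0 => _ [z _ <-]; exact: weber_sum_ge0.
  by exists (2^-1 *: (x + y)) => //; exact: convex_set_midpoint.
have xL1 : f x <= L + 1 by lra.
have yL1 : f y <= L + 1 by lra.
rewrite -(@ltr_pXn2r _ 2) ?nnegrE//; last exact: ltW.
apply: le_lt_trans (KP _ _ xL1 yL1) _; apply: lt_le_trans mq.
apply: (@le_lt_trans _ _ (K * (2 * t))); first by rewrite ler_pM2l//; lra.
by lra.
Qed.

(** The midpoint of [x] and [xbar] lies in [C], so [f] is at least [f xbar] there and the midpoint
    gap is at most [f x - f xbar]. *)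
Lemma weber_quadratic_growth xbar L : minimizers f C xbar ->
  exists2 K, 0 < K & forall x, C x -> f x <= L ->
    `|x - xbar| ^+ 2 <= K * (f x - f xbar).
Proof.
move=> [Cb bmin]; have [K K0 KP] := weber_uniformly_convex_sublevel L.
exists K => // x Cx xL.
apply: le_trans (KP _ _ xL (le_trans (bmin _ Cx) xL)) _; rewrite ler_pM2l//.
by have := bmin _ (convex_set_midpoint C_convex Cx Cb); lra.
Qed.

End WeberMinimizer.

(** * Estimates for one projected Weiszfeld step *)

Section WeiszfeldStep.
Context (R : realType) (H : completeNormedModType R).
Context (dot : {dot H for (@idfun R)}) (Hdot : norm_induced_by dot).
Context (m : nat) (a : 'I_m -> H) (w : 'I_m -> R).
Hypothesis w_gt0 : forall i, 0 < w i.
Context (C : set H) (C_neq0 : C !=set0) (C_closed : closed C).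
Hypothesis C_convex : convex_set C.
Local Notation f := (weber_sum a w).
Local Notation step x := (metric_proj C (weiszfeld a w x)).

Let norm_gt0 x i : ~ range a x -> 0 < `|x - a i|.
Proof.
move=> xA; rewrite normr_gt0 subr_eq0; apply/eqP => xE.
by apply: xA; exists i.
Qed.

(** The variational inequality of the projection, multiplied by s > 0: s (T x - p) is the sum of the
    c_i (a_i - p). *)
Lemma weiszfeld_step_vi x z : ~ range a x -> C z ->
  \sum_i w i / `|x - a i| * dot (a i - step x) (z - step x) <= 0.
Proof.
move=> xA Cz; set p := step x.
have [[i0 _]|nI] := pselect (exists i : 'I_m, True); last first.
  by rewrite big1// => i; exfalso; apply: nI; exists i.
set s := \sum_i w i / `|x - a i|.
have c0 i : 0 < w i / `|x - a i| by rewrite divr_gt0// norm_gt0.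
have s0 : 0 < s.
  by rewrite /s (bigD1 i0)//= ltr_pwDl// sumr_ge0// => j _; exact: ltW.
have := metric_proj_vi Hdot C_neq0 C_closed C_convex (weiszfeld a w x) Cz.
rewrite -/p -(pmulr_rle0 _ s0) -dotZl scalerBr.
rewrite /weiszfeld memNset// scalerA divff ?gt_eqF// scale1r /s scaler_suml.
rewrite -sumrB dot_suml; congr (_ <= _); apply: eq_bigr => i _.
by rewrite -scalerBr dotZl.
Qed.

Lemma weiszfeld_step_descent x : ~ range a x -> C x ->
  (\sum_i w i / `|x - a i|) * `|x - step x| ^+ 2 <= 2 * (f x - f (step x)).
Proof.
move=> xA Cx; have vi := weiszfeld_step_vi xA Cx; set p := step x in vi *.
rewrite -subr_ge0; apply: (@le_trans _ _
    (- 2 * \sum_i w i / `|x - a i| * dot (a i - p) (x - p))); first lra.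
rewrite /weber_sum -sumrB !mulr_sumr mulr_suml -sumrB; apply: ler_sum => i _.
have r0 := norm_gt0 i xA; have := normsqB Hdot (x - p) (a i - p).
rewrite opprB subrKA (dotC dot) (distrC (a i)) => rE.
set r := `|x - a i| in r0 rE *; set q := `|p - a i| in rE *.
have wr : w i = w i / r * r by rewrite divfK// gt_eqF.
have c0 : 0 < w i / r by rewrite divr_gt0.
(* The slack in each term is exactly c_i (q - r)^2: q is majorized by (q^2 + r^2) / (2 r), a
   quadratic touching it at [x]. *)
have h := mulr_ge0 (ltW c0) (sqr_ge0 (q - r)).
rewrite [X in _ <= 2 * (X * _ - _) - _]wr [X in _ <= 2 * (_ - X * _) - _]wr.
have {rE} : w i / r * r ^+ 2 = w i / r * (`|x - p| ^+ 2 -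
  2 * dot (a i - p) (x - p) + q ^+ 2) by rewrite rE.
by lra.
Qed.

(** Cauchy-Schwarz after splitting <x - b, x - z> through [p]. With [b = a i] and weight c_i, the
    last term sums to the left side of [weiszfeld_step_vi]. *)
Lemma norm_sub_le_vi (b x p z : H) :
  `|x - b| * (`|x - b| - `|z - b|) <=
  `|x - b| * `|x - p| + `|x - p| * `|p - z| + dot (b - p) (z - p).
Proof.
have h1 : dot (x - b) (z - b) <= `|x - b| * `|z - b| by exact: dot_le_norm.
have h2 : dot (x - b) (x - p) <= `|x - b| * `|x - p| by exact: dot_le_norm.
have h3 : dot (x - p) (p - z) <= `|x - p| * `|p - z| by exact: dot_le_norm.
have : `|x - b| ^+ 2 - dot (x - b) (z - b) =
    dot (x - b) (x - p) + dot (x - p) (p - z) + dot (b - p) (z - p).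
  by rewrite (normsqE Hdot) !dotE (dotC dot b x); ring.
by lra.
Qed.

Lemma weiszfeld_step_gap x z : ~ range a x -> C z ->
  f x - f z <= (\sum_i w i + (\sum_i w i / `|x - a i|) * `|step x - z|) *
               `|x - step x|.
Proof.
move=> xA Cz; have := weiszfeld_step_vi xA Cz; set p := step x => vi.
apply: (@le_trans _ _ ((\sum_i w i + (\sum_i w i / `|x - a i|) * `|p - z|) *
  `|x - p| + \sum_i w i / `|x - a i| * dot (a i - p) (z - p))); last by lra.
rewrite /weber_sum -sumrB mulr_suml -big_split mulr_suml -big_split.
apply: ler_sum => i _ /=.
have r0 := norm_gt0 i xA; have wr : w i = w i / `|x - a i| * `|x - a i|.
  by rewrite divfK// gt_eqF.
have c0 : 0 < w i / `|x - a i| by rewrite divr_gt0.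
have := ler_wpM2l (ltW c0) (norm_sub_le_vi (a i) x p z).
rewrite mulrA -wr !mulrDr mulrA -wr; lra.
Qed.

(** If the step did not move away from [c], then [weiszfeld_step_vi] would bound f c - f z by a
    multiple of |x - c|. The multiple stays bounded as [x] tends to [c], even when [c] is one of the
    a_i and s blows up. *)
Lemma weiszfeld_step_repulsion c z : C z -> f z < f c ->
  exists2 e, 0 < e & forall x, ~ range a x -> `|x - c| < e ->
    `|x - c| < `|step x - c|.
Proof.
move=> Cz fzc.
have [rho rho0 rhoP] : exists2 rho : R, 0 < rho &
    forall i, a i != c -> 2 * rho <= `|a i - c|.
  have [|rho rho0 rhoP] := @exists_pos_lower_bound R _
      (fun i => a i != c) (fun i => 2^-1 * `|a i - c|).
    by move=> i aic; rewrite mulr_gt0// normr_gt0 subr_eq0.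
  by exists rho => // i /rhoP; lra.
have W0 : 0 <= \sum_i w i by apply: sumr_ge0 => i _; exact: ltW.
set W := \sum_i w i in W0.
(* For a_i other than [c] and r = |x - a_i| >= rho, the errors are t r from replacing [x] by [c], 2
   t r from |x - p| <= 2 t, and 2 t (t + |c - z|) <= 2 t r (1 + |c - z| / rho). *)
pose K := 5 + 2 * (`|c - z| / rho).
have K0 : 0 < K by rewrite ltr_pwDl// mulr_ge0// divr_ge0// ltW.
pose q := (f c - f z) / (W * K + 1).
have WK : 0 < W * K + 1 by rewrite ltr_wpDl// mulr_ge0// ltW.
have q0 : 0 < q by rewrite divr_gt0// subr_gt0.
exists (Num.min rho q); first by rewrite lt_min rho0.
move=> x xA; rewrite lt_min => /andP[]; set t := `|x - c| => trho tq.
have t0 : 0 <= t by exact: normr_ge0.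
have vi := weiszfeld_step_vi xA Cz; set p := step x in vi *.
rewrite ltNge; apply/negP => pt.
have {tq} : W * (t * K) < f c - f z.
  apply: (@le_lt_trans _ _ (t * (W * K + 1))); first by lra.
  by rewrite -ltr_pdivlMr.
rewrite ltNge => /negP; apply.
(* The terms with [a i = c] are bounded below by [- w i * |z - c|], since
   [|p - c| <= |x - c|]; the other ones by [norm_sub_le_vi]. *)
suff : f c - f z <=
    \sum_i w i / `|x - a i| * dot (a i - p) (z - p) + W * (t * K).
  by lra.
rewrite /weber_sum -sumrB mulr_suml -big_split; apply: ler_sum => i _ /=.
have r0 := norm_gt0 i xA.
rewrite -mulrBr -mulrA -mulrDr ler_pM2l// -(ler_pM2l r0) [leRHS]mulrDr.
rewrite mulrA divff ?gt_eqF// mul1r.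
have rK : t * K = 5 * t + 2 * t * (`|c - z| / rho) by rewrite /K; ring.
have u0 : 0 <= `|c - z| / rho by rewrite divr_ge0// ltW.
have [aic|aic] := eqVneq (a i) c.
  rewrite aic subrr normr0 sub0r -/t.
  have h : - (`|c - p| * `|z - c|) <= dot (c - p) (z - c) by exact: dot_ge_norm.
  have -> : dot (c - p) (z - p) = `|c - p| ^+ 2 + dot (c - p) (z - c).
    by rewrite (normsqE Hdot) -dotDr [c - p + _]addrC subrKA.
  have := sqr_ge0 `|c - p|.
  have : 0 <= t * (t * K) by rewrite !mulr_ge0// ltW.
  have : `|c - p| * `|z - c| <= t * `|z - c| by rewrite ler_wpM2r// distrC.
  by lra.
have gap := norm_sub_le_vi (a i) x p z.
have rrho : rho <= `|x - a i|.
  have := ler_distD x (a i) c; have := rhoP i aic; rewrite (distrC (a i) x) -/t.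
  by lra.
have h1 : `|c - a i| <= t + `|x - a i| by rewrite /t (distrC x c) ler_distD.
have h2 : `|x - p| <= 2 * t.
  by have := ler_distD c x p; rewrite -/t (distrC c p); lra.
have h3 : `|p - z| <= t + `|c - z| by have := ler_distD c p z; lra.
set r := `|x - a i| in r0 gap rrho h1 *.
have h4 : `|x - p| * `|p - z| <= (2 * t) * (t + `|c - z|) by rewrite ler_pM.
have h5 : t * (t + `|c - z|) <= t * (r + r * (`|c - z| / rho)).
  rewrite ler_wpM2l// lerD//; first by lra.
  by rewrite mulrCA ler_peMr// ler_pdivlMr ?mul1r.
have := ler_wpM2l (ltW r0) h1; have := ler_wpM2l (ltW r0) h2.
rewrite rK; lra.
Qed.

End WeiszfeldStep.

(** The finitely many values of [a] are separated, so a sequence with short steps that stays close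
    to them cannot pass from one to another. *)
Lemma cvg_to_point_of_slow (R : realType) (H : normedModType R) (m : nat)
    (a : 'I_m -> H) (x : nat -> H) :
  (forall e : R, 0 < e ->
     exists N, forall n, (N <= n)%N -> `|x n - x n.+1| < e) ->
  (forall e : R, 0 < e ->
     exists N, forall n, (N <= n)%N -> exists i, `|x n - a i| < e) ->
  exists j, x @ \oo --> a j.
Proof.
move=> slow near.
have [|rho rho0 rhoP] := @exists_pos_lower_bound R _
    (fun ij : 'I_m * 'I_m => a ij.1 != a ij.2)
    (fun ij => 3^-1 * `|a ij.1 - a ij.2|).
  by move=> ij aij; rewrite mulr_gt0// normr_gt0 subr_eq0.
have [N1 slow1] := slow _ rho0; have [N2 near2] := near _ rho0.
pose N := maxn N1 N2; have [j xNj] := near2 N (leq_maxr _ _).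
(* Distinct values are at least 3 rho apart; 2 rho allows for one step. Only [a i = a j] can be
   concluded, since [a] may repeat values. *)
have sep i n : `|x n - a i| < rho -> `|x n - a j| < 2 * rho -> a i = a j.
  move=> xi xj; apply/eqP/negPn/negP => /(rhoP (i, j)) /=.
  by have := ler_distD (x n) (a i) (a j); rewrite (distrC (a i) (x n)); lra.
have xj n : (N <= n)%N -> `|x n - a j| < rho.
  move=> Nn; rewrite -(subnK Nn); elim: (n - N)%N => // k IH.
  have Nk : (N <= k + N)%N by exact: leq_addl.
  have N2k := leq_trans (leq_trans (leq_maxr _ _) Nk) (leqnSn _).
  have [i xi] := near2 (k.+1 + N)%N N2k.
  rewrite -(sep i (k.+1 + N)%N)//.
  have := slow1 _ (leq_trans (leq_maxl _ _) Nk); rewrite distrC -addSn.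
  by have := ler_distD (x (k + N)%N) (x (k.+1 + N)%N) (a j); lra.
exists j; apply/cvgrPdist_lt => e e0.
have er0 : 0 < Num.min e rho by rewrite lt_min e0.
have [N3 near3] := near _ er0.
exists (maxn N N3) => // n /=; rewrite geq_max => /andP[Nn N3n].
have [i] := near3 n N3n; rewrite lt_min => /andP[xie xirho].
by rewrite distrC -(sep i n)//; apply: lt_trans (xj n Nn) _; lra.
Qed.

(** * Convergence of the iterates *)

Section Iteration.
Context (R : realType) (H : completeNormedModType R).
Context (dot : {dot H for (@idfun R)}) (Hdot : norm_induced_by dot).
Context (m : nat) (a : 'I_m -> H) (w : 'I_m -> R).
Hypothesis w_gt0 : forall i, 0 < w i.
Context (C : set H) (C_closed : closed C) (C_convex : convex_set C).
Context (x : nat -> H).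
Hypotheses (x0C : C (x 0%N)) (xA : forall k, ~ range a (x k)).
Hypothesis xS : forall k, x k.+1 = metric_proj C (weiszfeld a w (x k)).
Local Notation f := (weber_sum a w).

Let C_neq0 : C !=set0. Proof. by exists (x 0%N). Qed.

Lemma weiszfeld_iter_in k : C (x k).
Proof. by case: k => // k; rewrite xS; exact: metric_proj_in. Qed.

Let dist_gt0 k i : 0 < `|x k - a i|.
Proof.
rewrite normr_gt0 subr_eq0; apply/eqP => xE.
by apply: (xA (k := k)); exists i.
Qed.

Let descent k : (\sum_i w i / `|x k - a i|) * `|x k - x k.+1| ^+ 2 <=
  2 * (f (x k) - f (x k.+1)).
Proof.
rewrite xS; apply: weiszfeld_step_descent => //; exact: weiszfeld_iter_in.
Qed.

Lemma weiszfeld_iter_nonincreasing :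
  {homo (fun k => f (x k)) : n k / (n <= k)%N >-> k <= n}.
Proof.
apply/nonincreasing_seqP => k.
have : 0 <= (\sum_i w i / `|x k - a i|) * `|x k - x k.+1| ^+ 2.
  rewrite mulr_ge0 ?sqr_ge0// sumr_ge0// => i _.
  by rewrite divr_ge0// ltW.
by have := descent k; lra.
Qed.

Lemma weiszfeld_iter_slow (i0 : 'I_m) (e : R) : 0 < e ->
  exists N, forall n, (N <= n)%N -> `|x n - x n.+1| < e.
Proof.
move=> e0; pose L := f (x 0%N).
have L0 : 0 < L.
  by apply: lt_le_trans (weber_term_le a w_gt0 _ i0); rewrite mulr_gt0.
have lbf : has_lbound (range (fun k => f (x k))).
  by exists 0 => _ [k _ <-]; exact: weber_sum_ge0.
have /cvg_ex[l fl] := nonincreasing_is_cvgn weiszfeld_iter_nonincreasing lbf.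
have fS : (fun k => f (x k.+1)) @ \oo --> l by have := fl; rewrite -cvg_shiftS.
have d0 : (f (x k) - f (x k.+1)) @[k --> \oo] --> (0 : R).
  by rewrite -(subrr l); apply: cvgB.
(* In the descent inequality s >= w_i0 / |x_n - a_i0| >= w_i0^2 / L, because w_i0 |x_n - a_i0| <=
   f(x_n) <= L. *)
pose q := e ^+ 2 * (w i0 ^+ 2 / (2 * L)).
have q0 : 0 < q by rewrite mulr_gt0 ?divr_gt0 ?exprn_gt0// mulr_gt0.
move/cvgrPdist_lt : d0 => /(_ _ q0)[N _ NP]; exists N => n Nn.
have := NP n Nn; rewrite /= sub0r normrN => /(le_lt_trans (ler_norm _)) dq.
have sn : w i0 ^+ 2 / L <= \sum_i w i / `|x n - a i|.
  apply: (@le_trans _ _ (w i0 / `|x n - a i0|)); last first.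
    rewrite [leRHS](bigD1 i0)//= lerDl sumr_ge0// => i _.
    by rewrite divr_ge0// ltW.
  rewrite ler_pdivrMr// mulrAC ler_pdivlMr// expr2 -mulrA ler_pM2l//.
  apply: le_trans (weber_term_le a w_gt0 _ i0) _.
  exact: weiszfeld_iter_nonincreasing.
rewrite -(@ltr_pXn2r _ 2) ?nnegrE//; last exact: ltW.
have wL : 0 < w i0 ^+ 2 / L by rewrite divr_gt0// exprn_gt0.
rewrite -(ltr_pM2l wL).
apply: (@le_lt_trans _ _ (2 * (f (x n) - f (x n.+1)))).
  by apply: le_trans (descent n); rewrite ler_wpM2r ?sqr_ge0.
apply: (@lt_le_trans _ _ (2 * q)); first by rewrite ltr_pM2l.
rewrite le_eqVlt; apply/orP; left; apply/eqP; rewrite /q; field.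
by rewrite gt_eqF.
Qed.

Lemma weiszfeld_iter_no_bad_limit c z :
  C z -> f z < f c -> ~ x @ \oo --> c.
Proof.
move=> Cz fzc xc.
have [e e0 eP] :=
  weiszfeld_step_repulsion Hdot w_gt0 C_neq0 C_closed C_convex Cz fzc.
move/cvgrPdist_lt : xc => xc; have [N _ NP] := xc _ e0.
have up n : (N <= n)%N -> `|x n - c| < `|x n.+1 - c|.
  by move=> Nn; rewrite xS; apply: eP => //; rewrite distrC; exact: NP.
(* The distance at [N.+1], unlike the one at [N], is known to be positive; later distances never
   fall below it. *)
have [M _ MP] := xc _ (le_lt_trans (normr_ge0 _) (up N (leqnn N))).
have low n : (N < n)%N -> `|x N.+1 - c| <= `|x n - c|.
  move=> Nn; rewrite -(subnK Nn); elim: (n - N.+1)%N => // k IH.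
  apply: le_trans IH _; rewrite addSn; apply/ltW/up.
  exact: leq_trans (leqnSn _) (leq_addl _ _).
have := MP (maxn M N.+1) (leq_maxl _ _); rewrite /= distrC ltNge.
by rewrite low// leq_maxr.
Qed.

Hypotheses (H_neq0 : exists v : H, v != 0) (a_ncol : ~ collinear (range a)).

Lemma weiszfeld_iter_cvg xbar : minimizers f C xbar -> x @ \oo --> xbar.
Proof.
move=> bminP; have [Cb bmin] := bminP.
have [i0 _] := exists_gram_gt0 Hdot H_neq0 a_ncol.
have slow := weiszfeld_iter_slow i0.
(* Either the iterates approach the set of the a_i and converge to some a_j, necessarily optimal, or
   they are at distance at least [e] from it infinitely often. *)
have [near|] := pselect (forall e : R, 0 < e ->
     exists N, forall n, (N <= n)%N -> exists i, `|x n - a i| < e).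
  have [j xj] := cvg_to_point_of_slow slow near.
  have Cj : C (a j).
    apply: (closed_cvg _ C_closed _ _ xj); apply: nearW.
    exact: weiszfeld_iter_in.
  have [fj|fj] := leP (f (a j)) (f xbar); last first.
    by case: (weiszfeld_iter_no_bad_limit Cb fj).
  have [K K0 KP] := weber_quadratic_growth Hdot w_gt0 H_neq0 a_ncol C_convex
    (f (a j)) bminP.
  have : `|a j - xbar| ^+ 2 <= 0.
    by apply: le_trans (KP _ Cj (lexx _)) _; rewrite pmulr_rle0// subr_le0.
  rewrite le_eqVlt ltNge sqr_ge0 orbF sqrf_eq0 normr_eq0 subr_eq0 => /eqP <-.
  exact: xj.
move=> /existsNP[e /not_implyP[e0 /forallNP far]].
have [K K0 KP] := weber_quadratic_growth Hdot w_gt0 H_neq0 a_ncol C_convex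
  (f (x 0%N)) bminP.
have fx0 n : f (x n) <= f (x 0%N) by exact: weiszfeld_iter_nonincreasing.
have growth n : `|x n - xbar| ^+ 2 <= K * (f (x n) - f xbar).
  by apply: KP => //; exact: weiszfeld_iter_in.
pose W := \sum_i w i; have W0 : 0 <= W by apply: sumr_ge0 => i _; exact: ltW.
pose D := K * f (x 0%N) + 1.
have fb0 : 0 <= f xbar by exact: weber_sum_ge0.
have D0 : 0 <= D by rewrite addr_ge0// mulr_ge0 ?(ltW K0)// weber_sum_ge0.
have xD n : `|x n - xbar| <= D.
  (* 2 u <= u^2 + 1 turns the bound on the squared distance into one on the distance without a
     square root. *)
  have := sqr_ge0 (`|x n - xbar| - 1).
  have : K * (f (x n) - f xbar) <= K * f (x 0%N).
    by rewrite ler_pM2l//; have := fx0 n; lra.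
  by have := growth n; have := normr_ge0 (x n - xbar); rewrite /D; lra.
(* Bounds the factor in [weiszfeld_step_gap] at an iterate [e]-far from all a_i, where s <= W /
   e. *)
pose A := W + W / e * D.
have A0 : 0 <= A by rewrite addr_ge0// mulr_ge0// divr_ge0// ltW.
apply/cvgrPdist_lt => r r0.
have KA : 0 < K * A + 1 by rewrite ltr_wpDl// mulr_ge0// ltW.
have [N NP] := slow _ (divr_gt0 (exprn_gt0 2 r0) KA).
(* A single far iterate with a short step suffices: its value is nearly optimal, and monotonicity
   passes this on to all later iterates. *)
have /existsNP[n /not_implyP[Nn /forallNP farn]] := far N.
have sn : \sum_i w i / `|x n - a i| <= W / e.
  rewrite mulr_suml ler_sum// => i _; rewrite ler_pM2l// lef_pV2 ?posrE//.
  by rewrite leNgt; apply/negP.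
exists n => // k nk.
rewrite /= distrC -(@ltr_pXn2r _ 2) ?nnegrE//; last exact: ltW.
apply: le_lt_trans (growth k) _.
have {}NP := NP n Nn; move: NP; rewrite ltr_pdivlMr// => NP.
have gap :=
  weiszfeld_step_gap Hdot w_gt0 C_neq0 C_closed C_convex (xA (k := n)) Cb.
rewrite -xS -/W in gap.
have gapA : f (x n) - f xbar <= A * `|x n - x n.+1|.
  apply: le_trans gap _; rewrite ler_wpM2r// lerD2l ler_pM//.
  by rewrite sumr_ge0// => i _; rewrite divr_ge0// ltW.
have := weiszfeld_iter_nonincreasing nk => fkn.
have h : K * (f (x k) - f xbar) <= K * (A * `|x n - x n.+1|).
  by rewrite ler_pM2l//; lra.
by have := normr_ge0 (x n - x n.+1); lra.
Qed.

End Iteration.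

Theorem theorem3p7 (R : realType) (H : completeNormedModType R)
    (dot : {dot H for (@idfun R)}) (Hdot : norm_induced_by dot)
    (C : set H) (C_neq0 : C !=set0) (C_closed : closed C)
    (C_convex : convex_set C)
    (m : nat) (a : 'I_m -> H) (w : 'I_m -> R)
    (a_ncol : ~ collinear (range a)) (w_gt0 : forall i, 0 < w i)
    (x : nat -> H) (x0C : C (x 0%N))
    (xS : forall k, x k.+1 = metric_proj C (weiszfeld a w (x k)))
    (xA : forall k, ~ range a (x k)) :
  exists xbar : H,
    minimizers (weber_sum a w) C = [set xbar] /\ x @ \oo --> xbar.
Proof.
(* In the zero space no set is [collinear], so [a_ncol] does not exclude it. *)
have [H_neq0|H0] := pselect (exists v : H, v != 0); last first.
  have z (v : H) : v = 0.
    by apply/eqP/negPn/negP => v0; apply: H0; exists v.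
  exists 0; split; last first.
    by rewrite (_ : x = cst 0); [exact: cvg_cst|apply/funext].
  apply/seteqP; split => [v _ /=|v ->]; first exact: z.
  by split => [|y _]; rewrite ?(z y)// -(z (x 0%N)).
have [xbar bmin] := exists_weber_minimizer Hdot w_gt0 H_neq0 a_ncol C_neq0
  C_closed C_convex.
have cvg := weiszfeld_iter_cvg Hdot w_gt0 C_closed C_convex x0C xA xS H_neq0
  a_ncol.
exists xbar; split; last exact: cvg.
apply/seteqP; split => [y ymin|_ ->]//=.
(* The iterates converge to every minimizer, so uniqueness of limits gives uniqueness of the
   minimizer. *)
by apply: (cvg_unique _ (cvg _ ymin) (cvg _ bmin)); exact: norm_hausdorff.
Qed.
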